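(* For any finite simple graph $G$, $c_2(G)\leq 2\tau(G)$.
   Context: All graphs are finite and simple. A subgraph complementation system for a graph $G=(V,E)$ is a finite collection (family) $\mathscr{C}$ of subsets of $V$ such that, for any two distinct vertices $u,v\in V$, $uv\in E$ if and only if $u$ and $v$ appear together in an odd number of sets in $\mathscr{C}$. The subgraph complementation number $c_2(G)$ is the minimum cardinality of a subgraph complementation system for $G$. $\tau(G)$ denotes the minimum cardinality of a vertex cover of $G$, i.e. of a set of vertices such that every edge of $G$ is incident to at least one vertex in the set. *)

(* Defs.v *)
From mathcomp Require Import all_boot.

Set Implicit Arguments.
Unset Strict Implicit.
Unset Printing Implicit Defensive.

Record sgraph := SGraph {
  vertex :> finType;
  edge : rel vertex;
  edge_sym : symmetric edge;
  edge_irrefl : irreflexive edge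
}.
Arguments edge {G} : rename.

Section Invariants.
Variable G : sgraph.

(* Families are sequences, so a set may be repeated and then counts with its
   multiplicity, both in the parity condition and in the cardinality. *)
Definition sc_system (C : seq {set G}) : bool :=
  [forall u : G, forall v : G,
    (u != v) ==>
    (edge u v == odd (count (fun A : {set G} => (u \in A) && (v \in A)) C))].

Definition has_sc_system (n : nat) : bool :=
  [exists C : n.-tuple {set G}, sc_system C].

Lemma sc_systemP (C : seq {set G}) :
  reflect (forall u v : G, u != v ->
    (edge u v <-> odd (count (fun A : {set G} => (u \in A) && (v \in A)) C)))
    (sc_system C).
Proof.
apply: (iffP idP) => [/forallP H u v uv | H].
  by move/forallP: (H u) => /(_ v); rewrite uv /= => /eqP->.
apply/forallP=> u; apply/forallP=> v; apply/implyP=> /H [H1 H2].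
by apply/eqP; apply/idP/idP.
Qed.

(* The two-element sets given by the edges form a system. *)
Lemma exists_sc_system : exists n : nat, has_sc_system n.
Proof.
pose F := [set A : {set G} | [exists u, exists v, edge u v && (A == [set u; v])]].
exists (size (enum F)); apply/existsP; exists (in_tuple (enum F)).
apply/sc_systemP => u v uv /=.
have sub (a b : G) : u \in [set a; b] -> v \in [set a; b] ->
    edge a b = edge u v /\ [set a; b] = [set u; v].
  rewrite !inE; move: uv => /eqP uv.
  by case/orP=> /eqP ua; case/orP=> /eqP vb; subst; rewrite ?(edge_sym a) ?[[set b; _]]setUC.
set p := fun A : {set G} => _.
have cnt A : A \in enum F -> p A = edge u v && (A == [set u; v]).
  rewrite mem_enum inE => /existsP[a /existsP[b /andP[eab /eqP->]]].
  apply/idP/idP; first by case/andP=> ua vb; have [<- ->] := sub a b ua vb; rewrite eab /=.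
  by case/andP=> _ /eqP->; rewrite /p !inE !eqxx orbT.
rewrite (eq_in_count cnt); case: (boolP (edge u v)) => euv /=; last by rewrite count_pred0.
rewrite count_uniq_mem ?enum_uniq // mem_enum inE.
suff -> : [exists a, exists b, edge a b && ([set u; v] == [set a; b])] by [].
by apply/existsP; exists u; apply/existsP; exists v; rewrite euv /=.
Qed.

Definition c2 : nat := ex_minn exists_sc_system.

Definition vertex_cover (S : {set G}) : bool :=
  [forall u : G, forall v : G, edge u v ==> (u \in S) || (v \in S)].

(* [setT] is only the starting point of the search; it is a vertex cover by
   [vertex_coverT], so this is a true minimum. *)
Definition tau : nat := #|[arg min_(S < [set: G] | vertex_cover S) #|S|]|.

Lemma vertex_coverT : vertex_cover [set: G].
Proof. by apply/forallP=> u; apply/forallP=> v; rewrite !inE implybT. Qed.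

End Invariants.

(* Main.v *)
Require Import Defs.
From mathcomp Require Import all_boot.

(** List the vertices of a minimum vertex cover. Each edge is a star edge of
    exactly one listed vertex [x], once the neighbors of [x] that occur later in
    the list are left out. If [N] is the set of the remaining neighbors of [x],
    the two sets [x |: N] and [N] contain together an odd number of times
    exactly the pairs [{x, y}] with [y] in [N]. *)

Section StarFamily.
Variable G : sgraph.
Implicit Types (u v x : G) (s : seq G).

Fixpoint star_family s : seq {set G} :=
  if s is x :: s' then
    let N := [set y | edge x y && (y \notin s')] in
    [:: x |: N, N & star_family s']
  else [::].

Lemma size_star_family s : size (star_family s) = 2 * size s.
Proof. by elim: s => //= x s ->; rewrite mulnS. Qed.

(** By induction on [s]. As [x] does not recur in the tail, the tail gives an edge [{x, y}] odd
    count exactly if [y] occurs there; the two sets at [x] do so exactly if it does not. *)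
Lemma odd_count_star_family s u v : uniq s -> u != v ->
  odd (count (fun A : {set G} => (u \in A) && (v \in A)) (star_family s)) =
  edge u v && ((u \in s) || (v \in s)).
Proof.
move=> + uv; elim: s => [|x s IHs] /=; first by rewrite andbF.
case/andP=> xs /IHs; rewrite !oddD !oddb !inE => ->.
case: (eqVneq u x) => [ux|_].
  (* Irreflexivity keeps [x] out of [N], so only [x |: N] can contain both vertices. *)
  subst x; rewrite (eq_sym v) (negPf uv) (negPf xs) edge_irrefl /=.
  by case: (edge u v); case: (v \in s).
case: (eqVneq v x) => [vx|_].
  subst x; rewrite (negPf xs) edge_irrefl (edge_sym v) /=.
  by case: (edge u v); case: (u \in s).
(* Away from [x] the sets [x |: N] and [N] agree, so their two contributions cancel. *)
by rewrite /= addbA addbb.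
Qed.

Lemma sc_system_star_family (S : {set G}) :
  vertex_cover S -> sc_system (star_family (enum S)).
Proof.
move=> coverS; apply/sc_systemP => u v uv.
rewrite odd_count_star_family ?enum_uniq // !mem_enum.
split=> [euv|/andP[]//]; rewrite euv /=.
by move/forallP/(_ u)/forallP/(_ v)/implyP: coverS; apply.
Qed.

Lemma c2_le_size (C : seq {set G}) : sc_system C -> c2 G <= size C.
Proof.
move=> scC; rewrite /c2; case: ex_minnP => n _; apply.
by apply/existsP; exists (in_tuple C).
Qed.

End StarFamily.

Theorem theorem3p5 (G : sgraph) : c2 G <= 2 * tau G.
Proof.
rewrite /tau; case: arg_minnP => [|S coverS _]; first exact: vertex_coverT.
by rewrite cardE -size_star_family; apply/c2_le_size/sc_system_star_family.
Qed.
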